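(* Let $(X,d)$ be a complete, connected, locally compact, non-compact geodesic space and let $\mathcal{K}(X)$ be the set of all non-empty compact subsets of $X$. For $K_0,K_1\in\mathcal{K}(X)$ set $u_{K_0}(K_1)=\min_{x\in K_1}u_{K_0}(x)$. Then the function $\rho:\mathcal{K}(X)\times\mathcal{K}(X)\to[0,+\infty)$, $$\rho(K_0,K_1):=-\tfrac12\,[u_{K_0}(K_1)+u_{K_1}(K_0)],$$ is a (well-defined, non-negative) pseudo-metric on $\mathcal{K}(X)$. Denote by $\sim$ the equivalence relation on $\mathcal{K}(X)$ induced by $\rho$, i.e. $K_0\sim K_1$ if $\rho(K_0,K_1)=0$. Moreover, $K_0\sim K_1$ if and only if there exists $c\in\mathbb{R}$ such that $u_{K_0}=u_{K_1}+c$ on $X$.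
   Context: A geodesic space is a length space in which the distance between any two points is attained by the length of some Lipschitz curve connecting them. For a non-empty closed set $H\subseteq X$, $d(x,H)=\inf_{h\in H}d(x,h)$. For a non-empty compact $K_0\subset X$, let $S_r(K_0)=\{x\in X: d(x,K_0)=r\}$ for $r>0$; the $K_0$-assigned dl-function is $u_{K_0}(x)=\lim_{r\to+\infty}[d(x,S_r(K_0))-r]$ (this limit exists for every $x\in X$ and defines a 1-Lipschitz function). A pseudo-metric is a non-negative symmetric function vanishing on the diagonal and satisfying the triangle inequality (distinct elements may be at distance $0$). *)

(* Defs.v *)
From mathcomp Require Import all_boot all_order all_algebra.
From mathcomp Require Import all_classical all_reals all_analysis.

Set Implicit Arguments.
Unset Strict Implicit.
Unset Printing Implicit Defensive.

Import Order.TTheory GRing.Theory Num.Theory.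
Import numFieldNormedType.Exports.

Local Open Scope classical_set_scope.
Local Open Scope ring_scope.

Section MetricSpace.
Context {R : realType} {X : metricType R}.
Implicit Types (x y : X) (H K : set X) (g : R -> X).

(* [cauchy_cvg] without the base point that [completeType] carries. *)
Definition complete_space : Prop :=
  forall F : set_system X, ProperFilter F -> cauchy F -> exists l : X, F --> l.

(* A partition of [a, b] is a list s of points with a < s_0 < ... and last
   element b, as in [itv_partition]; this is [variation] with |.| replaced by
   the distance of X. *)
Definition curve_variation (a b : R) g (s : seq R) : R :=
  let G := g \o nth b (a :: s) in
  \sum_(0 <= n < size s) mdist (G n) (G n.+1).

Definition curve_length (a b : R) g : \bar R :=
  ereal_sup [set (curve_variation a b g s)%:E | s in itv_partition a b].

(* g is totalized: only its values on [a, b] matter. *)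
Definition lipschitz_curve (a b : R) g x y : Prop :=
  [/\ a < b, g a = x, g b = y &
      exists k : R, {in `[a, b] &, forall s t, mdist (g s) (g t) <= k * `|s - t|}].

Definition curve_lengths x y : set (\bar R) :=
  [set l | exists a b g, lipschitz_curve a b g x y /\ l = curve_length a b g].

Definition length_space : Prop :=
  forall x y, (mdist x y)%:E = ereal_inf (curve_lengths x y).

Definition geodesic_space : Prop :=
  length_space /\ forall x y, curve_lengths x y (mdist x y)%:E.

(* The real infimum: meaningful for H non-empty, and 0 for H empty. *)
Definition set_dist x H : R := inf [set mdist x h | h in H].

Definition sphere K (r : R) : set X := [set x | set_dist x K = r].

Definition nonempty_compact : set (set X) := [set K | K !=set0 /\ compact K].

Definition dl_fun K x : R := lim ((set_dist x (sphere K r) - r) @[r --> +oo]).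

Definition dl_min K0 K1 : R := inf (dl_fun K0 @` K1).

Definition rho K0 K1 : R := - (2^-1 * (dl_min K0 K1 + dl_min K1 K0)).

Definition rho_equiv K0 K1 : Prop := rho K0 K1 = 0.

End MetricSpace.

Arguments complete_space {R} X.
Arguments length_space {R} X.
Arguments geodesic_space {R} X.
Arguments nonempty_compact {R} X.

Definition pseudometric_on {R : realType} {T : Type} (A : set T)
    (d : T -> T -> R) : Prop :=
  [/\ forall x y, A x -> A y -> 0 <= d x y,
      forall x, A x -> d x x = 0,
      forall x y, A x -> A y -> d x y = d y x
    & forall x y z, A x -> A y -> A z -> d x z <= d x y + d y z].

Definition equivalence_on {T : Type} (A : set T) (E : T -> T -> Prop) : Prop :=
  [/\ forall x, A x -> E x x,
      forall x y, A x -> A y -> E x y -> E y x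
    & forall x y z, A x -> A y -> A z -> E x y -> E y z -> E x z].

(* Main.v *)
(* Along a geodesic from [x] to a point of [S_s(K)], one crosses [S_r(K)]
   whenever [d(x, K) <= r <= s]; hence [d(x, S_r(K)) - r] is nondecreasing for
   [r >= d(x, K)], and it is at most the distance from [x] to some point of [K],
   so it converges. Spheres are non-empty because [X] is unbounded, by a
   Hopf-Rinow argument: otherwise, the supremum of the radii of compact balls
   would be finite, but completeness makes the ball of that radius compact and
   local compactness enlarges it.

   The key inequality is [u_K0(x) >= u_K0(K1) + u_K1(x)]. Together with
   [u_K(K) = 0] it gives [u_K0(K2) >= u_K0(K1) + u_K1(K2)], hence the
   pseudo-metric axioms. If [rho(K0, K1) = 0], then [u_K1(K0) = - u_K0(K1)] and
   the key inequality applied both ways forces [u_K0 - u_K1] to be constant. *)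

Require Import Defs.
From mathcomp Require Import all_boot all_order all_algebra.
From mathcomp Require Import all_classical all_reals all_analysis.
From mathcomp Require Import lra.

Set Implicit Arguments.
Unset Strict Implicit.
Unset Printing Implicit Defensive.

Import Order.TTheory GRing.Theory Num.Theory.
Import numFieldNormedType.Exports.

Local Open Scope classical_set_scope.
Local Open Scope ring_scope.

(** * 1-Lipschitz functions and intermediate points on geodesics *)

(** One-sided form of 1-Lipschitz; symmetry of [mdist] supplies the other side. *)
Definition nonexpansive (R : realType) (X : metricType R) (f : X -> R) : Prop :=
  forall x y, f x <= f y + mdist x y.

Section Nonexpansive.
Context {R : realType} {X : metricType R}.
Implicit Types (x y z : X) (K : set X) (f : X -> R).

Lemma nonexpansive_dist f : nonexpansive f ->
  forall x y, `|f x - f y| <= mdist x y.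
Proof.
move=> fN x y; rewrite ler_norml.
by have := fN x y; have := fN y x; rewrite (metric_sym y x) => *; apply/andP; split; lra.
Qed.

Lemma nonexpansive_continuous f : nonexpansive f -> continuous f.
Proof.
move=> fN x; apply/cvgrPdist_lt => e e0.
apply/nbhs_ballP; exists e => //= y; rewrite ballEmdist /= => xye.
exact: le_lt_trans (nonexpansive_dist fN x y) xye.
Qed.

Lemma nonexpansive_mdist x : nonexpansive (mdist x).
Proof. by move=> y z; rewrite (metric_sym y z); exact: metric_triangle. Qed.

Lemma nonexpansive_min f K : nonexpansive f -> nonempty_compact X K ->
  exists2 k, K k & forall y, K y -> f k <= f y.
Proof.
move=> fN [K0 Kc].
have [|k /set_mem Kk kmin] := compact_EVT_min (f := f) K0 Kc.
  exact/continuous_subspaceT/nonexpansive_continuous.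
by exists k => // y Ky; apply: kmin; rewrite inE.
Qed.

Lemma nonexpansive_max f K : nonexpansive f -> nonempty_compact X K ->
  exists2 k, K k & forall y, K y -> f y <= f k.
Proof.
move=> fN [K0 Kc].
have [|k /set_mem Kk kmax] := compact_EVT_max (f := f) K0 Kc.
  exact/continuous_subspaceT/nonexpansive_continuous.
by exists k => // y Ky; apply: kmax; rewrite inE.
Qed.

Lemma lipschitz_curve_continuous f a b (g : R -> X) x y :
  nonexpansive f -> lipschitz_curve a b g x y ->
  {within `[a, b], continuous (f \o g)}.
Proof.
move=> fN [ab _ _ [k gk]]; apply/subspace_continuousP => s sab.
apply/cvgrPdist_lt => e e0; rewrite near_withinE.
(* [k] may be zero or negative; [|k| + 1] is a positive constant to divide by. *)
have k0 : 0 < `|k| + 1 by rewrite ltr_wpDl.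
apply/nbhs_ballP; exists (e / (`|k| + 1)); first exact: divr_gt0.
move=> t; rewrite -ball_normE /= ltr_pdivlMr // => st tab.
apply: le_lt_trans (nonexpansive_dist fN _ _) _.
apply: le_lt_trans (gk _ _ sab tab) _.
apply: le_lt_trans st; rewrite mulrC ler_wpM2l //.
by rewrite (le_trans (ler_norm k)) // lerDl.
Qed.

Lemma curve_length_ge a b (g : R -> X) t : a < t < b ->
  ((mdist (g a) (g t) + mdist (g t) (g b))%:E <= curve_length a b g)%E.
Proof.
move=> /andP[at_ tb]; apply: ereal_sup_ubound; exists [:: t; b].
  by split => //=; rewrite at_ tb.
by rewrite /curve_variation /= big_nat_recr //= big_nat1.
Qed.

(** The intermediate value theorem along a geodesic gives [z]. The partition through [z] makes the
    length, which is d(x, y), at least d(x, z) + d(z, y). *)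
Lemma geodesic_intermediate f x y c : geodesic_space X -> nonexpansive f ->
  f x <= c <= f y ->
  exists2 z, f z = c & mdist x z + mdist z y = mdist x y.
Proof.
move=> [_ /(_ x y)[a [b [g [gl gd]]]]] fN fc.
have gc := lipschitz_curve_continuous fN gl.
case: gl => ab ga gb _; rewrite -{}ga -{}gb in gd fc *.
have [|t tab ft] := IVT (v := c) (ltW ab) gc.
  by move: fc => /andP[h1 h2]; rewrite /= ge_min h1 le_max h2 orbT.
exists (g t) => //; move: tab; rewrite in_itv /= !le_eqVlt => /andP[].
(* Endpoints are split off, since partition points increase strictly. *)
move=> /orP[/eqP <-|at_]; first by rewrite mdistxx add0r.
move=> /orP[/eqP ->|tb]; first by rewrite mdistxx addr0.
apply/eqP; rewrite eq_le metric_triangle andbT.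
by rewrite -lee_fin gd curve_length_ge // at_.
Qed.

End Nonexpansive.

(** * Hopf-Rinow: compactness of balls and unboundedness *)

Section HopfRinow.
Context {R : realType} {X : metricType R}.
Implicit Types (x y z p : X) (r s t e : R).

Definition cball p r : set X := [set x | mdist p x <= r].

Lemma cball_closed p r : closed (cball p r).
Proof.
have /continuous_closedP := nonexpansive_continuous (nonexpansive_mdist p).
by move=> /(_ [set y | y <= r]); apply; exact: closed_le.
Qed.

Lemma cball_limit p r (F : set_system X) l : ProperFilter F ->
  F (cball p r) -> F --> l -> cball p r l.
Proof.
move=> PF Fr Fl; apply: cball_closed => B lB.
exact: filter_ex (filterI Fr (Fl _ lB)).
Qed.

Lemma cball_compact_le p r s : r <= s -> compact (cball p s) ->
  compact (cball p r).
Proof.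
move=> rs cs; apply: subclosed_compact (cball_closed (p := p) (r := r)) cs _.
by move=> x /= /le_trans; exact.
Qed.

Lemma cball_project p t e : geodesic_space X -> 0 <= t -> 0 <= e ->
  exists f : X -> X, forall z, cball p (t + e) z ->
    cball p t (f z) /\ mdist (f z) z <= e.
Proof.
move=> Xg t0 e0.
suff /choice[f fP] : forall z, exists w, cball p (t + e) z ->
    cball p t w /\ mdist w z <= e by exists f.
move=> z; have [zt|tz] := leP (mdist p z) t.
  by exists z; rewrite mdistxx.
have [|w pw pwz] := geodesic_intermediate Xg (nonexpansive_mdist p)
    (x := p) (y := z) (c := t).
  by rewrite mdistxx t0 ltW.
by exists w; rewrite /cball /= -pwz pw => ?; split; lra.
Qed.

(** The image of [F] under the projection clusters at some [c] of the compact ball; the ultrafilter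
    then contains the preimage of the [e]-ball about [c], and the projection moves points by at most
    [e]. *)
Lemma ultra_preimage_cball p t e (F : set_system X) : geodesic_space X ->
  UltraFilter F -> 0 <= t -> 0 < e -> compact (cball p t) ->
  F (cball p (t + e)) -> exists2 c, cball p t c & F (cball c (e + e)).
Proof.
move=> Xg UF t0 e0 ct Fte.
have [f fP] := cball_project p Xg t0 (ltW e0).
have [|c [ctc cF]] := ct (f @ F) (fmap_proper_filter f ultra_proper).
  have Ff : F (f @^-1` cball p t) by apply: filterS Fte => z /fP[].
  exact: Ff.
exists c => //.
have [Fc|Fc] := in_ultra_setVsetC (f @^-1` ball c e) UF.
  apply: filterS (filterI Fte Fc) => z [/fP[_ fz]]; rewrite /= ballEmdist /= => cfz.
  by rewrite /cball /=; have := metric_triangle c (f z) z; lra.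
have [y [Fy cy]] := cF (~` ball c e) (ball c e) Fc (nbhsx_ballx c e e0).
by [].
Qed.

(** An ultrafilter on the ball is Cauchy: projecting to the ball of radius [r - e / 3] shows that it
    contains a ball of radius 2e/3. Completeness gives the limit. *)
Lemma cball_compact_limit p r : complete_space X -> geodesic_space X ->
  0 <= r -> (forall t, 0 <= t < r -> compact (cball p t)) ->
  compact (cball p r).
Proof.
move=> Xc Xg r0 ct; rewrite compact_ultra /= => F UF Fr.
suff /Xc[] : cauchy F.
  move=> l Fl; exists l; split => //.
  exact: cball_limit Fr Fl.
apply: cauchy_exP => e e0.
have e30 : 0 < e / 3 by lra.
suff [c Fc] : exists c, F (cball c (e / 3 + e / 3)).
  by exists c; apply: filterS Fc => y; rewrite /cball ballEmdist /= => ?; lra.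
(* If [r - e / 3] is negative, the ball about [p] is itself small enough. *)
have [re|er] := ltP r (e / 3).
  by exists p; apply: filterS Fr => y; rewrite /cball /= => ?; lra.
have [|||c _ ?] := @ultra_preimage_cball p (r - e / 3) (e / 3) F Xg UF _ e30.
- by lra.
- by apply: ct; apply/andP; split; lra.
- by rewrite subrK.
- by exists c.
Qed.

Lemma locally_compact_cball x : locally_compact [set: X] ->
  exists2 e, 0 < e & compact (cball x e).
Proof.
move=> /(_ x I)[U xU] [Uc _].
have /nbhs_ballP[e /= e0 xeU] : nbhs x U.
  exact: (@filterS _ (nbhs x) _ (fun y => [set: X] y -> U y) U (fun y h => h I) xU).
exists (e / 2); first by lra.
apply: subclosed_compact (cball_closed (p := x) (r := e / 2)) Uc _ => y xy.
apply: xeU; rewrite ballEmdist /=.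
by move: xy; rewrite /cball /= => ?; lra.
Qed.

(** Compactness yields one [e] for which all balls of radius 2e centred in the ball are compact; an
    ultrafilter on the larger ball contains one of them. *)
Lemma cball_compact_extend p r : geodesic_space X -> locally_compact [set: X] ->
  0 <= r -> compact (cball p r) -> exists2 e, 0 < e & compact (cball p (r + e)).
Proof.
move=> Xg Xl r0 cr.
have ce : \forall e \near (0 : R)^'+,
    cball p r `<=` (fun x => compact (cball x (e + e))).
  move/compact_near_coveringP : (cr); apply.
  move=> x _; have [d d0 cd] := locally_compact_cball x Xl.
  (* A ball of radius 2e about a point within d/4 of [x] then stays within [d] of [x]. *)
  exists (cball x (d / 4), [set e | e < d / 4]) => /=.
    split.
      apply/nbhs_ballP; exists (d / 4) => /=; first by lra.
      by move=> y; rewrite ballEmdist /cball /= => /ltW.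
    by apply: nbhs_right_lt; lra.
  move=> [y e] [/= xy ed].
  apply: subclosed_compact (cball_closed (p := y) (r := e + e)) cd _ => z.
  move: xy; rewrite /cball /=.
  by have := metric_triangle x y z; lra.
have [e [/= e0 {}ce]] := filter_ex (filterI (nbhs_right_gt (0 : R)) ce).
exists e => //; rewrite compact_ultra /= => F UF Fr.
have [c rc Fc] := ultra_preimage_cball Xg UF r0 e0 cr Fr.
have := ce _ rc; rewrite compact_ultra /= => /(_ F UF Fc)[l [_ Fl]].
exists l; split => //.
exact: cball_limit Fr Fl.
Qed.

Lemma noncompact_unbounded p M : complete_space X -> locally_compact [set: X] ->
  ~ compact [set: X] -> geodesic_space X -> exists y, M < mdist p y.
Proof.
move=> Xc Xl Xnc Xg; apply: contrapT => /forallNP bnd; apply: Xnc.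
have cT s : M <= s -> cball p s = [set: X].
  move=> Ms; apply/seteqP; split => // x _; rewrite /cball /=.
  by have /negP := bnd x; rewrite -leNgt => /le_trans; exact.
apply: contrapT => Xnc.
pose A := [set r : R | 0 <= r /\ compact (cball p r)].
have A0 : A 0.
  split=> //; suff -> : cball p 0 = [set p] by exact: compact_set1.
  apply/seteqP; split => x; rewrite /cball /=; last by move=> ->; rewrite mdistxx.
  move=> px; apply/esym/mdist_positivity/eqP.
  by rewrite eq_le px mdist_ge0.
have AM : has_ubound A.
  exists M => r [_ cr]; rewrite leNgt; apply/negP => /ltW /cT rT.
  by apply: Xnc; rewrite -rT.
have As : has_sup A by split => //; exists 0.
have s0 : 0 <= sup A by exact: ub_le_sup.
have cs : compact (cball p (sup A)).
  apply: cball_compact_limit => // t /andP[t0 ts].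
  have [r [_ cr] tr] := sup_gt (ex_intro _ 0 A0) ts.
  exact: cball_compact_le (ltW tr) cr.
have [e e0 ce] := cball_compact_extend Xg Xl s0 cs.
have : sup A + e <= sup A by apply: ub_le_sup => //; split => //; lra.
by lra.
Qed.

End HopfRinow.

(** * Distance to a set, and cluster points at infinity *)

Section SetDist.
Context {R : realType} {X : metricType R}.
Implicit Types (x y : X) (K : set X).

Lemma set_dist_le x K k : K k -> set_dist x K <= mdist x k.
Proof.
by move=> Kk; apply: ge_inf; [exists 0 => _ [h _ <-]; exact: mdist_ge0 | exists k].
Qed.

Lemma le_set_dist x K m : K !=set0 -> (forall k, K k -> m <= mdist x k) ->
  m <= set_dist x K.
Proof.
move=> [k Kk] mK; apply: lb_le_inf; first by exists (mdist x k), k.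
by move=> _ [h Kh <-]; exact: mK.
Qed.

Lemma set_dist_ge0 x K : K !=set0 -> 0 <= set_dist x K.
Proof. by move=> K0; apply: le_set_dist => // *; exact: mdist_ge0. Qed.

Lemma set_dist_mem x K : K x -> set_dist x K = 0.
Proof.
move=> Kx; apply/eqP; rewrite eq_le set_dist_ge0 ?andbT; last by exists x.
by rewrite -(mdistxx x) set_dist_le.
Qed.

Lemma set_dist_nonexpansive K : K !=set0 -> nonexpansive (set_dist ^~ K).
Proof.
move=> K0 x y; rewrite -lerBlDr; apply: le_set_dist => // k Kk.
by have := set_dist_le x Kk; have := metric_triangle x y k; lra.
Qed.

Lemma set_dist_attained x K : nonempty_compact X K ->
  exists2 k, K k & set_dist x K = mdist x k.
Proof.
move=> Knc; have [k Kk kmin] := nonexpansive_min (nonexpansive_mdist x) Knc.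
exists k => //; apply/eqP; rewrite eq_le set_dist_le //=.
by apply: le_set_dist => //; exists k.
Qed.

Lemma set_dist_lt_add x K e : K !=set0 -> 0 < e ->
  exists2 k, K k & mdist x k < set_dist x K + e.
Proof.
move=> [k Kk] e0; have [|_ [h Kh <-] he] := @inf_adherent _ [set mdist x h | h in K] _ e0.
  by split; [exists (mdist x k), k | exists 0 => _ [h _ <-]; exact: mdist_ge0].
by exists h.
Qed.

(** Serves to replace witnesses in [K] that vary with the radius by a single point. *)
Lemma compact_cluster_pinfty K (u : R -> X) : compact K -> (forall r, K (u r)) ->
  exists2 k, K k & forall e s, 0 < e -> exists2 r, s <= r & mdist k (u r) < e.
Proof.
move=> Kc Ku; have uK : \forall r \near +oo, K (u r) by exact: nearW.
have [k [Kk ku]] := Kc (u @ +oo) _ uK.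
exists k => // e s e0.
have us : (u @ +oo) (u @` [set r | s <= r]).
  by apply: filterS (nbhs_pinfty_ge (num_real s)) => r sr; exists r.
have [_ [[r sr <-]]] := ku _ _ us (nbhsx_ballx k e e0).
by rewrite ballEmdist; exists r.
Qed.

End SetDist.

(** * Convergence and Lipschitz bound of dl-functions *)

Section DlFunction.
Context {R : realType} {X : metricType R}.
Context (Xg : geodesic_space X) (Xu : forall (p : X) M, exists y, M < mdist p y).
Implicit Types (x y : X) (K : set X) (r s : R).

Lemma sphere_nonempty K r : nonempty_compact X K -> 0 <= r -> sphere K r !=set0.
Proof.
move=> Knc r0; have [[k Kk] _] := Knc.
have [h _ hmax] := nonexpansive_max (nonexpansive_mdist k) Knc.
(* No point of [K] is farther from [k] than [h], so this choice forces d(y, K) >= r, while d(k, K) =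
   0. *)
have [y ky] := Xu k (r + mdist k h).
have [|z zr _] := geodesic_intermediate Xg (set_dist_nonexpansive Knc.1)
    (x := k) (y := y) (c := r); last by exists z.
rewrite set_dist_mem // r0 /=; apply: le_set_dist => [|j Kj]; first by exists k.
have := metric_triangle k j y; rewrite (metric_sym y j).
by have := hmax _ Kj; lra.
Qed.

Definition pre_dl K x r : R := set_dist x (sphere K r) - r.

(** Beyond its crossing of S_r(K), a geodesic from [x] to S_s(K) still has length at least s - r. *)
Lemma le_pre_dl K x r s : nonempty_compact X K -> set_dist x K <= r -> r <= s ->
  pre_dl K x r <= pre_dl K x s.
Proof.
move=> Knc xr rs; have r0 := le_trans (set_dist_ge0 x Knc.1) xr.
rewrite /pre_dl lerBrDr; apply: le_set_dist => [|y ys].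
  exact: sphere_nonempty (le_trans r0 rs).
have [|z zr <-] := geodesic_intermediate Xg (set_dist_nonexpansive Knc.1)
    (x := x) (y := y) (c := r).
  by rewrite xr ys.
have := set_dist_le x (zr : sphere K r z).
have := set_dist_nonexpansive Knc.1 y z; rewrite ys zr metric_sym.
by lra.
Qed.

Lemma pre_dl_nonexpansive K r : nonempty_compact X K -> 0 <= r ->
  nonexpansive (pre_dl K ^~ r).
Proof.
move=> Knc r0 x y.
have := set_dist_nonexpansive (sphere_nonempty Knc r0) x y.
by rewrite /pre_dl; lra.
Qed.

(** For [k] in [K] nearest to some y on the sphere, d(x, y) <= d(x, k) + r; the same [k] serves
    every [x]. *)
Lemma pre_dl_le_mdist K r : nonempty_compact X K -> 0 <= r ->
  exists2 k, K k & forall x, pre_dl K x r <= mdist x k.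
Proof.
move=> Knc r0; have [y yr] := sphere_nonempty Knc r0.
have [k Kk yk] := set_dist_attained y Knc.
exists k => // x; have := set_dist_le x yr.
have := metric_triangle x k y; rewrite (metric_sym k y) -yk yr.
by rewrite /pre_dl; lra.
Qed.

Lemma cvg_pre_dl K x : nonempty_compact X K -> cvg (pre_dl K x r @[r --> +oo]).
Proof.
(* Truncation makes [f] monotone on the whole line without changing it for large [r]. *)
move=> Knc; pose f r := pre_dl K x (Num.max r (set_dist x K)).
have fnd : {homo f : r s / r <= s}.
  move=> r s rs; apply: le_pre_dl => //; first by rewrite le_max lexx orbT.
  by rewrite ge_max !le_max rs lexx orbT.
have fub : has_ubound (range f).
  have [h _ hmax] := nonexpansive_max (nonexpansive_mdist x) Knc.
  exists (mdist x h) => _ [r _ <-].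
  have [|k Kk kx] := @pre_dl_le_mdist K (Num.max r (set_dist x K)) Knc.
    by rewrite le_max set_dist_ge0 ?orbT //; case: Knc.
  exact: le_trans (kx x) (hmax _ Kk).
apply/cvg_ex; exists (sup (range f)).
apply: cvg_trans (nondecreasing_cvgr fnd fub); apply: near_eq_cvg.
apply: filterS (nbhs_pinfty_ge (num_real (set_dist x K))) => r xr.
by rewrite /f max_l.
Qed.

(** By monotonicity the limit is the supremum over r >= d(x, K); this lemma and [dl_fun_le] replace
    limits from here on. *)
Lemma pre_dl_le_dl_fun K x r : nonempty_compact X K -> set_dist x K <= r ->
  pre_dl K x r <= dl_fun K x.
Proof.
move=> Knc xr; apply: (limr_ge (cvg_pre_dl (x := x) Knc)).
apply: filterS (nbhs_pinfty_ge (num_real r)) => s rs.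
exact: le_pre_dl.
Qed.

Lemma dl_fun_le K x M : nonempty_compact X K ->
  (forall r, set_dist x K <= r -> pre_dl K x r <= M) -> dl_fun K x <= M.
Proof.
move=> Knc xM; apply: (limr_le (cvg_pre_dl (x := x) Knc)).
by apply: filterS (nbhs_pinfty_ge (num_real (set_dist x K))) => s /xM.
Qed.

Lemma dl_fun_nonexpansive K : nonempty_compact X K -> nonexpansive (dl_fun K).
Proof.
move=> Knc x y; apply: dl_fun_le => // r xr.
pose s := Num.max r (set_dist y K).
have rs : r <= s by rewrite le_max lexx.
have ys : set_dist y K <= s by rewrite le_max lexx orbT.
have s0 := le_trans (set_dist_ge0 y Knc.1) ys.
apply: le_trans (le_pre_dl Knc xr rs) _.
apply: le_trans (pre_dl_nonexpansive Knc s0 x y) _.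
by rewrite lerD2r pre_dl_le_dl_fun.
Qed.

(** * Minima of dl-functions over compact sets *)

Lemma dl_min_attained K0 K1 : nonempty_compact X K0 -> nonempty_compact X K1 ->
  exists2 x : X, K1 x /\ dl_fun K0 x = dl_min K0 K1 &
    forall y : X, K1 y -> dl_fun K0 x <= dl_fun K0 y.
Proof.
move=> K0nc K1nc.
have [k Kk kmin] := nonexpansive_min (dl_fun_nonexpansive K0nc) K1nc.
have kl : lbound (dl_fun K0 @` K1) (dl_fun K0 k) by move=> _ [h Kh <-]; exact: kmin.
exists k => //; split => //; apply/eqP; rewrite eq_le; apply/andP; split.
  by apply: lb_le_inf => //; exists (dl_fun K0 k), k.
by apply: ge_inf; [exists (dl_fun K0 k) | exists k].
Qed.

Lemma dl_min_le K0 K1 x : nonempty_compact X K0 -> nonempty_compact X K1 ->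
  K1 x -> dl_min K0 K1 <= dl_fun K0 x.
Proof.
by move=> K0nc K1nc K1x; have [y [_ <-]] := dl_min_attained K0nc K1nc; exact.
Qed.

Lemma dl_min_self K : nonempty_compact X K -> dl_min K K = 0.
Proof.
move=> Knc; apply/eqP; rewrite eq_le; apply/andP; split; last first.
  have [k [Kk <-] _] := dl_min_attained Knc Knc.
  (* At radius 0, [pre_dl] is a distance, hence non-negative. *)
  apply: (@le_trans _ _ (pre_dl K k 0)); last first.
    by apply: pre_dl_le_dl_fun; rewrite ?set_dist_mem.
  rewrite /pre_dl subr0; apply: set_dist_ge0.
  exact: sphere_nonempty.
(* For the upper bound, each radius gives a point of [K] where [pre_dl] is at most 0; at a cluster
   point of these, [dl_fun] is at most 0. *)
have /choice[u uP] : forall r, exists k, K k /\ (0 <= r -> pre_dl K k r <= 0).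
  move=> r; have [r0|r0] := leP 0 r; last first.
    by have [[k Kk] _] := Knc; exists k; split.
  have [k Kk kr] := pre_dl_le_mdist Knc r0.
  by exists k; split => // _; rewrite -(mdistxx k).
have [k Kk ku] := compact_cluster_pinfty Knc.2 (fun r => (uP r).1).
apply: le_trans (dl_min_le Knc Knc Kk) _; apply: dl_fun_le => // r.
rewrite set_dist_mem // => r0; apply/ler_addgt0Pr => e e0.
have [s rs kus] := ku _ r e0; have s0 := le_trans r0 rs.
have := le_pre_dl (x := k) Knc _ rs; rewrite set_dist_mem // => /(_ r0).
have := pre_dl_nonexpansive Knc s0 k (u s).
by have := (uP s).2 s0; lra.
Qed.

(* A point [y] of the [K0]-sphere of radius [r] almost nearest to [x] lies on the
   [K1]-sphere of radius [r' = d(y, K1) = d(y, k)], so [d(x, y) - r] splits as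
   [(d(x, y) - r') + (d(k, y) - r)]; the witness [k] depends on [r] and is
   replaced by a cluster point as [r] tends to infinity. *)
Lemma dl_min_add_dl_fun_le K0 K1 x :
  nonempty_compact X K0 -> nonempty_compact X K1 ->
  dl_min K0 K1 + dl_fun K1 x <= dl_fun K0 x.
Proof.
move=> K0nc K1nc; apply/ler_addgt0Pr => e e0.
have e20 : 0 < e / 2 by lra.
(* As [h] is the point of [K1] farthest from [K0], the [K0]-sphere of radius [r] is at distance at
   least r - d(h, K0) from [K1]. *)
have [h K1h hmax] := nonexpansive_max (set_dist_nonexpansive K0nc.1) K1nc.
have /choice[u uP] : forall r, exists k, K1 k /\ (0 <= r -> forall r1,
    set_dist x K1 <= r1 -> r1 <= r - set_dist h K0 ->
    pre_dl K1 x r1 + pre_dl K0 k r <= pre_dl K0 x r + e / 2).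
  move=> r; have [r0|r0] := leP 0 r; last by exists h; split.
  have [y yr xy] := set_dist_lt_add x (sphere_nonempty K0nc r0) e20.
  have [k K1k yk] := set_dist_attained y K1nc.
  exists k; split => // _ r1 xr1 r1r.
  have r1y : r1 <= set_dist y K1.
    have := set_dist_nonexpansive K0nc.1 y k.
    by have := hmax _ K1k; rewrite yr yk; lra.
  have := le_pre_dl K1nc xr1 r1y.
  have := set_dist_le (K := sphere K1 (set_dist y K1)) x (erefl : sphere K1 _ y).
  have := set_dist_le k yr; move: yk xy.
  by rewrite /pre_dl (metric_sym k y); lra.
have [k K1k ku] := compact_cluster_pinfty K1nc.2 (fun r => (uP r).1).
have := dl_min_le K0nc K1nc K1k.
suff : dl_fun K0 k <= dl_fun K0 x + e - dl_fun K1 x by lra.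
apply: dl_fun_le => // r0 kr0; rewrite lerBrDl -lerBrDr.
apply: dl_fun_le => // r1 xr1; rewrite lerBrDr.
(* For r >= s, monotonicity applies at both [k] and [x], and r1 <= r - d(h, K0). *)
pose s := Num.max (Num.max r0 (set_dist x K0)) (r1 + set_dist h K0).
have [r sr kur] := ku _ s e20.
move: sr; rewrite !ge_max => /andP[/andP[r0r xr] r1r].
have rge0 := le_trans (set_dist_ge0 x K0nc.1) xr.
have := le_pre_dl K0nc kr0 r0r.
have := pre_dl_nonexpansive K0nc rge0 k (u r).
have := pre_dl_le_dl_fun K0nc xr.
have := (uP r).2 rge0 _ xr1; rewrite lerBrDr => /(_ r1r).
by lra.
Qed.

Lemma dl_min_triangle K0 K1 K2 : nonempty_compact X K0 ->
  nonempty_compact X K1 -> nonempty_compact X K2 ->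
  dl_min K0 K1 + dl_min K1 K2 <= dl_min K0 K2.
Proof.
move=> K0nc K1nc K2nc; have [x [K2x <-] _] := dl_min_attained K0nc K2nc.
apply: le_trans (dl_min_add_dl_fun_le x K0nc K1nc).
by rewrite lerD2l dl_min_le.
Qed.

(** [dl_fun K1] has minimum 0 over [K1], which the shift moves to [c]. *)
Lemma dl_min_shift K0 K1 c : nonempty_compact X K0 -> nonempty_compact X K1 ->
  (forall x, dl_fun K0 x = dl_fun K1 x + c) -> dl_min K0 K1 = c.
Proof.
move=> K0nc K1nc K01.
have [x [K1x x0] _] := dl_min_attained K1nc K1nc.
have [y [K1y <-] ymin] := dl_min_attained K0nc K1nc.
have := ymin _ K1x; have := dl_min_le K1nc K1nc K1y.
by rewrite !K01 x0 dl_min_self //; lra.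
Qed.

(** * The pseudo-metric and its equivalence relation *)

(** Non-negativity is [dl_min_triangle] for [K0], [K1], [K0]; the triangle inequality adds its
    instances for [K0], [K1], [K2] and for [K2], [K1], [K0]. *)
Lemma rho_pseudometric : pseudometric_on (nonempty_compact X) rho.
Proof.
split=> [K0 K1 h0 h1|K h|K0 K1 _ _|K0 K1 K2 h0 h1 h2]; rewrite /rho.
- have := dl_min_triangle h0 h1 h0; rewrite dl_min_self //.
  by move: (dl_min K0 K1) (dl_min K1 K0) => a b; lra.
- by rewrite dl_min_self //; lra.
- by congr (- (_ * _)); exact: addrC.
- have := dl_min_triangle h0 h1 h2; have := dl_min_triangle h2 h1 h0.
  move: (dl_min K0 K1) (dl_min K1 K0) (dl_min K0 K2) => a01 a10 a02.
  by move: (dl_min K2 K0) (dl_min K1 K2) (dl_min K2 K1) => a20 a12 a21; lra.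
Qed.

Lemma rho_equivP K0 K1 : nonempty_compact X K0 -> nonempty_compact X K1 ->
  rho_equiv K0 K1 <-> exists c, forall x, dl_fun K0 x = dl_fun K1 x + c.
Proof.
rewrite /rho_equiv /rho => h0 h1; split=> [r0|[c K01]].
  exists (dl_min K0 K1) => x.
  have := dl_min_add_dl_fun_le x h0 h1; have := dl_min_add_dl_fun_le x h1 h0.
  move: (dl_fun K0 x) (dl_fun K1 x) r0.
  by move: (dl_min K0 K1) (dl_min K1 K0) => a b u v; lra.
(* The two minima are [c] and [- c], which cancel. *)
rewrite (dl_min_shift h0 h1 K01) (dl_min_shift (c := - c) h1 h0); first by lra.
by move=> x; rewrite K01; lra.
Qed.

End DlFunction.

Lemma pseudometric_equivalence (R : realType) (T : Type) (A : set T)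
    (d : T -> T -> R) :
  pseudometric_on A d -> equivalence_on A (fun x y => d x y = 0).
Proof.
move=> [d0 dxx dC dT]; split => // [x y Ax Ay|x y z Ax Ay Az xy yz].
  by rewrite dC.
by have := dT _ _ _ Ax Ay Az; have := d0 _ _ Ax Az; lra.
Qed.

Theorem theorem1p9 (R : realType) (X : metricType R) :
  complete_space X ->
  connected [set: X] ->
  locally_compact [set: X] ->
  ~ compact [set: X] ->
  geodesic_space X ->
  [/\ forall (K : set X) (x : X), nonempty_compact X K ->
        cvg ((set_dist x (sphere K r) - r) @[r --> +oo]),
      forall K0 K1 : set X, nonempty_compact X K0 -> nonempty_compact X K1 ->
        exists2 x : X, K1 x /\ dl_fun K0 x = dl_min K0 K1 &
          forall y : X, K1 y -> dl_fun K0 x <= dl_fun K0 y,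
      pseudometric_on (nonempty_compact X) rho,
      equivalence_on (nonempty_compact X) rho_equiv
    & forall K0 K1 : set X, nonempty_compact X K0 -> nonempty_compact X K1 ->
        (rho_equiv K0 K1 <->
         exists c : R, forall x : X, dl_fun K0 x = dl_fun K1 x + c)].
Proof.
move=> Xc _ Xl Xnc Xg.
have Xu p M := noncompact_unbounded p M Xc Xl Xnc Xg.
have rhoP := rho_pseudometric Xg Xu.
split.
- by move=> K x; exact: cvg_pre_dl.
- by move=> K0 K1; exact: dl_min_attained.
- exact: rhoP.
- exact: pseudometric_equivalence rhoP.
- by move=> K0 K1; exact: rho_equivP.
Qed.
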